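(* Let $\alpha,\beta$ be integers different from $1$, and let $m=v_2(\alpha-1)$, $n=v_2(\beta-1)$, $\ell=v_2(\alpha-\beta)$. Suppose $n>1$ and $m>n=\ell$. Then $|G_2|=2^{m+4n}$, the nilpotency class of $G_2$ is $3$, $o(a)=2^{m+n}$, $o(b)=2^{2n}$ and $o(c)=2^{n+1}$.
   Context: $G(\alpha,\beta)=\langle A,B\mid A^{[A,B]}=A^{\alpha},\ B^{[B,A]}=B^{\beta}\rangle$ with $[x,y]=x^{-1}y^{-1}xy$, $y^x=x^{-1}yx$, and $C=[A,B]$. The group $G(\alpha,\beta)$ is finite and nilpotent, hence the direct product of its Sylow subgroups; $G_2$ denotes its Sylow $2$-subgroup and $a,b,c$ denote the images of $A,B,C$ under the canonical projection $G(\alpha,\beta)\to G_2$. $v_2$ is the $2$-adic valuation and $o(x)$ the order of $x$. *)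

(* Defs.v *)
From mathcomp Require Import all_boot all_order all_algebra all_fingroup all_solvable.
Set Implicit Arguments.
Unset Strict Implicit.
Unset Printing Implicit Defensive.
Local Open Scope group_scope.

Definition expgz (gT : finGroupType) (x : gT) (k : int) : gT :=
  match k with Posz n => x ^+ n | Negz n => x ^- n.+1 end.

(* the defining relations of G(alpha,beta):
   A^[A,B] = A^alpha,  B^[B,A] = B^beta  (mathcomp: x ^ y = y^-1 x y,
   [~ x, y] = x^-1 y^-1 x y, as in the paper) *)
Definition rels_G (alpha beta : int) (gT : finGroupType) (x y : gT) : Prop :=
  x ^ [~ x, y] = expgz x alpha /\ y ^ [~ y, x] = expgz y beta.

(* G, with distinguished elements x, y (images of A, B), is (isomorphic to)
   the group presented by <A,B | rels_G>: it is generated by x,y, they satisfy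
   the relations, and any pair of elements of a finite group satisfying the
   relations is the image of (x,y) under a morphism defined on G. *)
Definition presents_G (alpha beta : int) (gT : finGroupType)
    (G : {group gT}) (x y : gT) : Prop :=
  [/\ G :=: <<[set x; y]>>, rels_G alpha beta x y &
      forall (hT : finGroupType) (u v : hT), rels_G alpha beta u v ->
        exists f : {morphism G >-> hT}, f x = u /\ f y = v].

Definition v2 (z : int) : nat := logn 2 `|z|%N.

(* Main.v *)
Require Import Defs.
From mathcomp Require Import all_boot all_order all_algebra all_fingroup all_solvable.
From mathcomp Require Import zify ring.
Set Implicit Arguments.
Unset Strict Implicit.
Unset Printing Implicit Defensive.
Import GRing.Theory.

(* Only the 2-parts of orders are followed, so nilpotency of G is never needed.

   Upper bound. As only finitely many powers matter, alpha = 1 + a and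
   beta = 1 + b with a = 2^m u and b = 2^n v natural numbers, u and v odd, a >= b.
   Put c = [x, y]. Conjugating x by y^(b+1) c = c y in two ways gives
   y^s c^(b+2) x^t = c^(a+2), where 2^(2n-1) | s and 2^(2m-1) | t. Hence some
   c^h, with h an odd multiple of 2^n, is a product F E of commuting elements
   F of <y^(2^(2n-1))> and E of <x^(2^(2m-1))>. Conjugating x by c^h is then the
   same as conjugating it by F, and conjugating y the same as by E; comparing
   both shows that an odd multiple of 2^(m+n) is the exponent of a power of x in
   <y^(2^(2n))>, and an odd multiple of 2^(2n) that of a power of y in
   <x^(2^(m+n+1))>. So x^(2^(m+n)) and y^(2^(2n)) have odd order. Since
   G = <c><y><x>, this bounds |G|_2 by 2^(m+4n).

   Lower bound. Modulo x^(2^m), resp. y^(2^n), the expected group has an abelian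
   normal subgroup <x, c, y^(2^n)>, resp. <y, c, x^(2^m)>, with cyclic quotient,
   so it acts on triples by a translation and a shear. The product of these two
   permutation representations has an image of order at least 2^(m+4n), which is therefore
   isomorphic to the Sylow 2-subgroup. *)

(** * 2-adic arithmetic of exponents *)

(** With [d = b], the exponent of [y] that accumulates when [x] is conjugated by [y ^+ k]: the
    [j]-th step contributes [y ^+ (j * d)], which then passes [c ^+ j]. *)
Definition twist (d k : nat) : nat := \sum_(j < k) j * d * d.+1 ^ j.

(** Each [d.+1 ^ j] is 1 modulo [d], so the sum is [d * 'C(k, 2)] modulo [d ^ 2]. *)
Lemma dvdn_twist d k r :
  r %| d * 'C(k, 2) -> r %| d ^ 2 -> r %| twist d k.
Proof.
move=> rdk rdd; suff [q ->]: exists q, twist d k = (d * 'C(k, 2) + d ^ 2 * q)%N.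
  by rewrite dvdn_add // dvdn_mulr.
elim: k {rdk} => [|k [q IHk]]; first by exists 0%N; rewrite /twist big_ord0 !muln0.
have [s Es]: exists s, d.+1 ^ k = (1 + d * s)%N.
  elim: {q IHk} k => [|k [s Es]]; first by exists 0%N; rewrite muln0.
  by exists (1 + d * s + s)%N; rewrite expnS Es; ring.
exists (q + k * s)%N; rewrite /twist big_ord_recr /= -/(twist d k) IHk Es binS bin1.
ring.
Qed.

Lemma bin2_double k : 'C(k, 2) * 2 = k * k.-1.
Proof.
rewrite bin2 muln2 halfK; case: k => [//|k].
by rewrite [k.+1.-1]/= oddM /= andNb subn0.
Qed.

Lemma dvdn_bin2 q k : 2 ^ q.+1 %| k * k.-1 -> 2 ^ q %| 'C(k, 2).
Proof. by rewrite -bin2_double expnSr dvdn_pmul2r. Qed.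

(** Lifting the exponent: for [p > 1] each squaring gains exactly one factor 2, and an odd power
    gains none. *)
Lemma exp_2adic p u n h : 1 < p -> odd u -> odd h ->
  exists2 r, odd r & (2 ^ p * u).+1 ^ (2 ^ n * h) = (2 ^ (p + n) * r).+1.
Proof.
move=> p_gt1 odd_u odd_h.
have [r odd_r Er]: exists2 r, odd r & (2 ^ p * u).+1 ^ (2 ^ n) = (2 ^ (p + n) * r).+1.
  elim: n => [|n [r odd_r Er]]; first by exists u; rewrite // addn0 expn1.
  (* With [q = p + n], the square of [1 + 2^q r] is [1 + 2^(q+1) (r + 2^(q-1) r^2)], and the
     correction is even since [q > 1]. *)
  exists (r + 2 ^ (p + n).-1 * r ^ 2)%N.
    by rewrite oddD odd_r oddM oddX /= -(subnKC p_gt1).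
  have -> : (p + n.+1 = (p + n).-1.+2)%N by lia.
  rewrite expnSr expnM Er {1}(_ : (p + n = (p + n).-1.+1)%N); last by lia.
  by rewrite !expnS; ring.
rewrite expnM Er; set q := (2 ^ _)%N.
have even_q : ~~ odd q by rewrite oddX addn_eq0; case: p p_gt1 {Er q}.
have [s Es]: exists s, (q * r).+1 ^ h = (q * r * h + (q * r * q * r) * s).+1.
  elim: (h) => [|k [s Es]]; first by exists 0%N; rewrite !muln0.
  exists (k + s + q * r * s)%N; rewrite expnS Es; ring.
exists (r * h + r * q * r * s)%N; last by rewrite Es; ring.
by rewrite oddD !oddM odd_r odd_h (negbTE even_q).
Qed.

Lemma eqmodn_cancel p d q k k' : 0 < p -> coprime d q ->
  k * (p * q) = k' * (p * q) %[mod p * d] -> k = k' %[mod d].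
Proof.
move=> p0 dq; wlog le_kk: k k' / k' <= k.
  by move=> H E; case/orP: (leq_total k' k) => ?; [|symmetry]; apply: H.
move/eqP; rewrite !(mulnCA _ p) eqn_mod_dvd ?leq_pmul2l ?leq_mul2r ?le_kk ?orbT //.
by rewrite -mulnBr dvdn_pmul2l // -mulnBl Gauss_dvdl // -eqn_mod_dvd // => /eqP.
Qed.

Lemma part2_dvdn N k w : odd w -> N %| 2 ^ k * w -> N`_2 %| 2 ^ k.
Proof.
move=> odd_w dvd_N; have w_gt0 : 0 < w by case: w odd_w {dvd_N}.
have := partn_dvd 2 _ dvd_N; rewrite muln_gt0 expn_gt0 w_gt0 => /(_ isT).
rewrite partnM ?expn_gt0 // (@part_p'nat 2 w) -?odd_2'nat // muln1.
by rewrite (@part_pnat_id 2 (2 ^ k)) ?pnatX ?pnat_id.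
Qed.

Local Open Scope group_scope.

(** * Collection formulas from the relations with natural exponents *)

Definition relsN (a b : nat) (gT : finGroupType) (x y : gT) : Prop :=
  x ^ [~ x, y] = x ^+ a.+1 /\ y ^ [~ y, x] = y ^+ b.+1.

Lemma relsN_sym a b (gT : finGroupType) (x y : gT) :
  relsN a b x y -> relsN b a y x.
Proof. by case. Qed.

Lemma relsN_xc a b (gT : finGroupType) (x y : gT) : relsN a b x y ->
  forall i k, x ^+ i * [~ x, y] ^+ k = [~ x, y] ^+ k * x ^+ (i * a.+1 ^ k).
Proof.
case=> + _ i k; move: [~ x, y] => c xc.
elim: k => [|k IHk]; first by rewrite expn0 muln1 mulg1 mul1g.
rewrite expgSr mulgA IHk -!mulgA (conjgC _ c) conjXg xc -expgM.
by rewrite mulnCA expnS.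
Qed.

(** Mirror of [relsN_xc]: exchanging the generators inverts their commutator. *)
Lemma relsN_cy a b (gT : finGroupType) (x y : gT) : relsN a b x y ->
  forall j k, [~ x, y] ^+ k * y ^+ j = y ^+ (j * b.+1 ^ k) * [~ x, y] ^+ k.
Proof.
move=> /relsN_sym rel j k; have := relsN_xc rel j k.
rewrite -[[~ y, x]]invg_comm expVgn => E.
by apply: (mulgI ([~ x, y] ^- k)); rewrite mulKg mulgA -E mulgKV.
Qed.

(** Induction from [x ^ y = x * c], using [c ^ (y ^+ k) = y ^+ (k * b) * c]. *)
Lemma relsN_conj_expg a b (gT : finGroupType) (x y : gT) : relsN a b x y ->
  forall k, x ^ (y ^+ k) = x * y ^+ twist b k * [~ x, y] ^+ k.
Proof.
move=> rel k; have := relsN_cy rel; have := conjg_mulR x y.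
move: [~ x, y] => c xy cy.
elim: k => [|k IHk]; first by rewrite /twist big_ord0 conjg1 !mulg1.
have cyk : c ^ (y ^+ k) = y ^+ (k * b) * c.
  apply: (mulgI (y ^+ k)); rewrite -conjgC mulgA -expgD.
  by have := cy k 1%N; rewrite !expg1 expn1 => ->; rewrite mulnS.
rewrite expgS conjgM xy conjMg IHk cyk -!mulgA; congr (_ * _).
rewrite /twist big_ord_recr /= expgD -mulgA; congr (_ * _).
by rewrite mulgA cy -mulgA expgSr.
Qed.

Lemma relsN_expg_comm a b (gT : finGroupType) (x y : gT) : relsN a b x y ->
  forall k, x ^+ k * y = y * (x ^+ k * [~ x, y] ^+ k * x ^- twist a k).
Proof.
move=> /relsN_sym rel k; have E := relsN_conj_expg rel k.
rewrite -[[~ y, x]]invg_comm expVgn in E; move: [~ x, y] E => c E.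
rewrite !mulgA; apply: (mulIg (x ^+ twist a k)); rewrite mulgKV.
apply: (mulIg (c ^- k)); rewrite mulgK -!mulgA (mulgA y) -E.
by rewrite -conjgC.
Qed.

Lemma relsN_fundamental a b (gT : finGroupType) (x y : gT) : relsN a b x y ->
  y ^+ twist b b.+1 * [~ x, y] ^+ b.+2 * x ^+ twist a a.+1
    = [~ x, y] ^+ a.+2.
Proof.
move=> rel; have := relsN_expg_comm rel a.+1.
have := relsN_cy rel 1%N 1%N; have := relsN_xc rel 1 1.
have := relsN_conj_expg rel b.+1.
move: [~ x, y] => c xyb xc cy xy1.
rewrite !expn1 !mul1n !expg1 in cy xc.
(* The left side is expanded by [relsN_conj_expg]; on the right [x ^ c] is [x ^+ a.+1], whose
   conjugate by [y] is given by [relsN_expg_comm]. *)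
have E : x ^ (y ^+ b.+1 * c) = x ^ (c * y) by rewrite cy.
rewrite !conjgM xyb [x ^ c]conjgE xc mulKg [RHS]conjgE xy1 mulKg in E.
apply: (mulgI (x ^+ a.+1 * c^-1)).
have -> : x ^+ a.+1 * c^-1 = c^-1 * x by rewrite -(mulKg c (x ^+ a.+1)) -xc mulgA mulgK.
move/(congr1 (mulg^~ (x ^+ twist a a.+1))): E.
rewrite mulgKV conjgE [c ^+ b.+2]expgSr [c ^+ a.+2]expgS -!mulgA (mulgA x c) xc.
by rewrite -mulgA mulKg.
Qed.

Lemma relsN_norm_cycle a b (gT : finGroupType) (x y : gT) : relsN a b x y ->
  forall k, [~ x, y] \in 'N(<[y ^+ k]>).
Proof.
move=> rel k; have := relsN_cy rel k 1; move: [~ x, y] => c.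
rewrite !expg1 expn1 -groupV -cycle_subG norms_cycle => ck.
by rewrite conjgE invgK mulgA ck mulgK expgM mem_cycle.
Qed.

(** * Upper bounds on the 2-parts of the orders *)

(** Such a [z] commutes with [c], whereas moving [c] past a power of [y] raises that power to
    [b.+1]. *)
Lemma relsN_central a b (gT : finGroupType) (x y z : gT) : relsN a b x y ->
  z \in <[x]> -> z \in <[y]> -> [/\ commute z x, commute z y & z ^+ b = 1].
Proof.
move=> rel /cycleP[i zx] /cycleP[j zy].
have zX : commute z x by rewrite zx; apply/commute_sym/commuteX.
have zY : commute z y by rewrite zy; apply/commute_sym/commuteX.
split=> //; have zC : commute z [~ x, y].
  by apply/cent1P; rewrite cent1C groupR // cent1C; apply/cent1P.
have := relsN_cy rel j 1; move: [~ x, y] zC => c zC.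
rewrite expg1 expn1 expgM -zy -zC => /mulIg; rewrite expgS.
by rewrite -[LHS]mulg1 => /mulgI.
Qed.

(* [c ^+ (a - b) = F * E] with F a power of y and E one of x; conjugating by c
   shows E ^+ a \in <[x]> :&: <[y]>, which is central. Hence [~ E, F] is central
   of odd order dividing v, and F ^+ v, E ^+ v commute. *)
Lemma relsN_factor_power m n u v (gT : finGroupType) (x y : gT) :
    relsN (2 ^ m * u) (2 ^ n * v) x y -> odd u -> odd v -> 1 < n -> n < m ->
    2 ^ n * v <= 2 ^ m * u ->
  exists h g f, [/\ odd h,
    [~ x, y] ^+ (2 ^ n * h) = y ^+ (2 ^ (2 * n).-1 * g) * x ^+ (2 ^ (2 * m).-1 * f)
    & commute (y ^+ (2 ^ (2 * n).-1 * g)) (x ^+ (2 ^ (2 * m).-1 * f))].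
Proof.
set a := (2 ^ m * u)%N; set b := (2 ^ n * v)%N.
move=> rel odd_u odd_v n_gt1 lt_nm le_ba.
have dvd_tw p w : 0 < p -> 2 ^ (2 * p).-1 %| twist (2 ^ p * w) (2 ^ p * w).+1.
  move=> p_gt0; have -> : ((2 * p).-1 = p + p.-1)%N by lia.
  apply: dvdn_twist.
    rewrite expnD; apply: dvdn_mul; first by rewrite dvdn_mulr.
    by apply: dvdn_bin2; rewrite prednK // dvdn_mull //= dvdn_mulr.
  by rewrite expnMn -expnM dvdn_mulr // dvdn_exp2l //; lia.
have /dvdnP[f Ef] := dvd_tw m u (ltn_trans (ltnW n_gt1) lt_nm).
have /dvdnP[g Eg] := dvd_tw n v (ltnW n_gt1).
have Rf := relsN_fundamental rel; rewrite -/a -/b in Ef Eg Rf.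
have cN := relsN_norm_cycle rel.
have cE := relsN_xc rel (twist a a.+1).
have cen := relsN_central rel.
set c := [~ x, y] in Rf cN cE cen *.
set E := x ^+ twist a a.+1 in Rf cE.
(* This conjugation moves the power of [y] to the right of [c ^+ b.+2], which can then be cancelled
   in [Rf]. *)
set F := (y ^+ twist b b.+1) ^ (c ^+ b.+2).
have DFE : c ^+ (a - b) = F * E.
  apply: (mulgI (c ^+ b.+2)); rewrite -expgD mulgA -conjgC Rf.
  by congr (c ^+ _); lia.
have cF k : F ^ (c ^+ k) \in <[y ^+ twist b b.+1]>.
  have cNk i : c ^+ i \in 'N(<[y ^+ twist b b.+1]>).
    by apply: groupX; apply: cN.
  by rewrite /F !(memJ_norm _ (cNk _)) cycle_id.
have cyc_sub z : z \in <[y ^+ twist b b.+1]> -> z \in <[y]>.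
  by apply/subsetP; rewrite cycle_subG mem_cycle.
have cenE : E ^+ a \in <[y]>.
  have : E ^+ a.+1 = (F ^ c)^-1 * F * E.
    have := cE 1%N; rewrite expg1 expn1 expgM -/E => Ec.
    apply: (mulgI (F ^ c)); rewrite -(mulgA _ F E) mulKVg -DFE.
    apply: (mulgI c); rewrite mulgA -conjgC -mulgA -Ec mulgA -DFE.
    by rewrite -expgSr -expgS.
  rewrite expgSr => /mulIg ->; rewrite groupM ?groupV // cyc_sub //.
    by have := cF 1%N; rewrite expg1.
  by have := cF 0%N; rewrite expg0 conjg1.
have [zx zy zb] := cen _ (groupX a (mem_cycle x _)) cenE.
rewrite -/E in zx zy zb.
have Eh : (a - b = 2 ^ n * (2 ^ (m - n) * u - v))%N.
  by rewrite mulnBr mulnA -expnD subnKC // ltnW.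
have odd_h : odd (2 ^ (m - n) * u - v).
  rewrite oddB; last first.
    rewrite -(leq_pmul2l (expn_gt0 2 n)) mulnA -expnD subnKC //; exact: ltnW.
  by rewrite oddM oddX odd_v subn_eq0 leqNgt lt_nm.
(* The difference with 1 is divisible both by [a] and by [2^(m+n)], hence by [a * 2^n] because [u]
   is odd. *)
have [s Es]: exists s, (a.+1 ^ (a - b) = (a * (2 ^ n * s)).+1)%N.
  have [r _ Er] := exp_2adic n (ltn_trans n_gt1 lt_nm) odd_u odd_h.
  have [t Et]: exists t, (a.+1 ^ (a - b) = (a * t).+1)%N.
    elim: (a - b)%N => [|k [t Et]]; first by exists 0%N; rewrite muln0.
    by exists (1 + a * t + t)%N; rewrite expnS Et; ring.
  have /dvdnP[s Es]: 2 ^ n %| t.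
    rewrite -(@Gauss_dvdr _ u) ?coprimeXl ?coprime2n //.
    move: Et; rewrite Eh Er /a expnD -!mulnA => -[/eqP].
    by rewrite eqn_pmul2l ?expn_gt0 // => /eqP <-; rewrite dvdn_mulr.
  by exists s; rewrite Et Es [(2 ^ n * _)%N]mulnC.
have zs : (E ^+ (a * (2 ^ n * s))) ^+ v = 1.
  rewrite -expgM (_ : _ * v = a * b * s)%N; last by rewrite /b; ring.
  by rewrite expgM (expgM E) zb expg1n.
set z0 := E ^+ (a * (2 ^ n * s)) in zs.
have z0C w : commute (E ^+ a) w -> commute z0 w.
  by move=> zw; rewrite /z0 expgM; apply/commute_sym/commuteX/commute_sym.
have z0E : commute z0 E by apply/commuteX/z0C.
have z0F : commute z0 F.
  have /cycleP[i ->] : F \in <[y]> by have := cF 0%N; rewrite expg0 conjg1; apply: cyc_sub.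
  exact/commuteX/z0C.
have EFz : [~ E, F] = z0.
  have := cE (a - b)%N; rewrite DFE Es expgM -/E expgS -/z0 => EFE.
  have EF : E * F = F * E * z0.
    by apply: (mulIg E); rewrite -mulgA EFE -!mulgA z0E.
  by apply: (mulgI (F * E)); rewrite -EF commgEl conjgE !mulgA mulgK mulgV mul1g.
have comFE : commute (F ^+ v) (E ^+ v).
  apply/commuteX/commute_sym/commgP/eqP.
  by rewrite commgX EFz.
have Dv : c ^+ ((a - b) * v) = F ^+ v * E ^+ v.
  (* The correction is [z0 ^+ 'C(v, 2)]; as [v] is odd it divides ['C(v, 2)], and [z0 ^+ v = 1]. *)
  rewrite expgM DFE expMg_Rmul ?EFz; try exact/commute_sym.
  by rewrite bin2odd // expgM zs expg1n mulg1.
have [j Ej]: exists j, F = y ^+ (twist b b.+1 * j).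
  have /cycleP[j Ej] := cF 0%N; exists j; rewrite expgM -Ej.
  by rewrite expg0 conjg1.
exists ((2 ^ (m - n) * u - v) * v)%N, (g * j * v)%N, (f * v)%N.
have <- : F ^+ v = y ^+ (2 ^ (2 * n).-1 * (g * j * v)).
  by rewrite Ej -expgM Eg; congr (y ^+ _); ring.
have <- : E ^+ v = x ^+ (2 ^ (2 * m).-1 * (f * v)).
  by rewrite /E -expgM Ef; congr (x ^+ _); ring.
split=> //; first by rewrite oddM odd_h.
by rewrite -Dv Eh; congr (c ^+ _); ring.
Qed.

Lemma relsN_expg_mul a b (gT : finGroupType) (x y : gT) : relsN a b x y ->
  forall i k j, exists s,
    (y ^+ i * [~ x, y] ^+ k) ^+ j = y ^+ (i * s) * [~ x, y] ^+ (k * j).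
Proof.
move=> rel i k j; have := relsN_cy rel; move: [~ x, y] => c cy.
elim: j => [|j [s IHj]]; first by exists 0%N; rewrite !muln0 mulg1.
exists (1 + s * b.+1 ^ k)%N; rewrite expgS IHj mulnDr muln1 expgD -!mulgA.
by congr (_ * _); rewrite mulgA cy -mulnA -mulgA -expgD mulnS.
Qed.

(* With [c ^+ (H * h) = F * E], conjugating x by [F = y ^+ (H * k)] amounts to
   conjugating it by [c ^+ (H * h)]. *)
Lemma relsN_expg_x a b (gT : finGroupType) (x y : gT) H h k f :
    relsN a b x y ->
    [~ x, y] ^+ (H * h) = y ^+ (H * k) * x ^+ f ->
    commute (y ^+ (H * k)) (x ^+ f) ->
  exists t, x ^+ ((a.+1 ^ (H * h)).-1 * h)
    = y ^+ (twist b (H * k) * t + H * k * k) * x ^+ (f * k).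
Proof.
move=> rel EC comFE.
have [t Et] := relsN_expg_mul rel (twist b (H * k)) (H * k)%N h.
exists t; have := relsN_xc rel 1%N (H * h)%N; have := relsN_conj_expg rel (H * k)%N.
move: [~ x, y] EC Et => c EC Et xy xc.
rewrite mul1n expg1 in xc.
have xE : x ^ (c ^+ (H * h)) = x ^+ (a.+1 ^ (H * h)) by rewrite conjgE xc mulKg.
have xf : x ^ (x ^+ f) = x by rewrite conjgE (commuteX f (commute_refl x)) mulKg.
rewrite EC comFE conjgM xf xy in xE.
have {}xE : x ^+ (a.+1 ^ (H * h)).-1 = y ^+ twist b (H * k) * c ^+ (H * k).
  by apply: (mulgI x); rewrite -expgS prednK ?expn_gt0 // -xE mulgA.
(* Raising to the power [h] turns [c ^+ (H * k)] into a power of [c ^+ (H * h)], to which [EC]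
   applies. *)
rewrite expgM xE Et expgD -mulgA; congr (_ * _).
by rewrite mulnAC (expgM c) EC expgMn // -!expgM.
Qed.

(** An even order would force [r] and [2 * i] to have the same parity. *)
Lemma odd_order_of_expg (gT : finGroupType) (x : gT) r i :
  odd r -> x ^+ r = x ^+ (2 * i) -> odd #[x].
Proof.
move=> odd_r /eqP; rewrite eq_expg_mod_order => /eqP E; apply/negPn/negP => ev.
have /(modn_dvdm r) Er : 2 %| #[x] by rewrite dvdn2.
have /(modn_dvdm (2 * i)) Ei : 2 %| #[x] by rewrite dvdn2.
by have := modn2 r; rewrite odd_r -Er E Ei modnMr.
Qed.

Lemma expgV_order (gT : finGroupType) (x : gT) k :
  x ^- k = x ^+ (k * #[x].-1).
Proof. by rewrite mulnC expgM -invg_expg expVgn. Qed.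

(** The even multiple of [P] is absorbed on the left without changing the parity of the exponent
    there. *)
Lemma odd_expg_eq (gT : finGroupType) (x z : gT) P r e :
  odd r -> x ^+ (P * r) = z * x ^+ (P * (2 * e)) ->
  exists2 r', odd r' & (x ^+ P) ^+ r' = z.
Proof.
move=> odd_r E; exists (r + 2 * e * #[x].-1)%N.
  by rewrite oddD odd_r -mulnA oddM.
by rewrite -expgM mulnDr expgD E [(P * (2 * e * _))%N]mulnA -expgV_order mulgK.
Qed.

Lemma dvdn_twist_2exp p w k q r :
  r <= p + q -> r <= 2 * p -> 2 ^ r %| twist (2 ^ p * w) (2 ^ q.+1 * k).
Proof.
move=> r1 r2; apply: dvdn_twist.
  apply: dvdn_trans (dvdn_exp2l 2 r1) _; rewrite expnD.
  by rewrite dvdn_mul ?dvdn_mulr // dvdn_bin2 // -mulnA dvdn_mulr.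
by rewrite expnMn -expnM dvdn_mulr // dvdn_exp2l // mulnC.
Qed.

(** The odd factor [w] collects all odd cofactors met on the way. In the last equality the power of
    [x] from [relsN_factor_power] has disappeared, since [2^(m+n)] divides [2^(2m-1)]. *)
Lemma relsN_bounds m n u v (gT : finGroupType) (x y : gT) :
    relsN (2 ^ m * u) (2 ^ n * v) x y -> odd u -> odd v -> 1 < n -> n < m ->
    2 ^ n * v <= 2 ^ m * u ->
  exists w g, [/\ odd w, x ^+ (2 ^ (m + n) * w) = 1, y ^+ (2 ^ (2 * n) * w) = 1
    & [~ x, y] ^+ (2 ^ n * w) = y ^+ (2 ^ (2 * n).-1 * g)].
Proof.
move=> rel odd_u odd_v n_gt1 lt_nm le_ba.
have m_gt1 := ltn_trans n_gt1 lt_nm.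
have [h [g [f [odd_h EC comFE]]]] := relsN_factor_power rel odd_u odd_v n_gt1 lt_nm le_ba.
set X := x ^+ (2 ^ (m + n)); set Y := y ^+ (2 ^ (2 * n)).
have [r1 odd_r1 [j1 Xr1]] : exists2 r, odd r & exists j, X ^+ r = Y ^+ j.
  have [r odd_r Er] := exp_2adic n m_gt1 odd_u odd_h.
  have EG : (2 ^ (2 * n).-1 * g = 2 ^ n * (2 ^ n.-1 * g))%N.
    by rewrite mulnA -expnD; congr (2 ^ _ * _)%N; lia.
  have EC' := EC; have comFE' := comFE; rewrite EG in EC' comFE'.
  have [t] := relsN_expg_x rel EC' comFE'; rewrite Er [_.+1.-1]/= -EG.
  have /dvdnP[q ->]: 2 ^ (2 * n) %| twist (2 ^ n * v) (2 ^ (2 * n).-1 * g) * t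
                                     + 2 ^ (2 * n).-1 * g * (2 ^ n.-1 * g).
    apply: dvdn_add; first apply: dvdn_mulr.
      rewrite (_ : (2 * n).-1 = (2 * n).-2.+1)%N; last by lia.
      by apply: dvdn_twist_2exp => //; lia.
    (* The power of 2 here is [2^(3n-2)], a multiple of [2^(2n)] because [n > 1]. *)
    rewrite mulnACA -expnD dvdn_mulr // dvdn_exp2l //; lia.
  have -> : (2 ^ (2 * m).-1 * f * (2 ^ n.-1 * g)
             = 2 ^ (m + n) * (2 * (2 ^ (m - 3) * (f * g))))%N.
    rewrite mulnACA -expnD (_ : _ + _ = m + n + 1 + (m - 3))%N; last by lia.
    by rewrite !expnD expn1 -!mulnA.
  rewrite -[(_ * r * h)%N]mulnA => /odd_expg_eq[|r' odd_r' Er'].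
    by rewrite oddM odd_r.
  by exists r' => //; exists q; rewrite -/X in Er'; rewrite Er' mulnC expgM.
have [r2 odd_r2 [j2 Yr2]] : exists2 r, odd r & exists j, Y ^+ r = X ^+ (2 * j).
  have [r odd_r Er] := exp_2adic n n_gt1 odd_v odd_h.
  (* The factor [#[x].-1] plays the role of -1: with the generators exchanged the commutator is
     inverted, and exponents must stay natural. *)
  pose k := (2 ^ ((2 * m).-1 - n) * f * #[x].-1)%N.
  have EK : (2 ^ n * k = 2 ^ (2 * m).-1 * f * #[x].-1)%N.
    by rewrite /k !mulnA -expnD; congr (2 ^ _ * _ * _)%N; lia.
  have EC' : [~ y, x] ^+ (2 ^ n * h)
             = x ^+ (2 ^ n * k) * y ^+ (2 ^ (2 * n).-1 * g * #[y].-1).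
    by rewrite EK -!expgV_order -invMg -EC -invg_comm expVgn.
  have comFE' : commute (x ^+ (2 ^ n * k)) (y ^+ (2 ^ (2 * n).-1 * g * #[y].-1)).
    by rewrite EK !(expgM _ _ _.-1); apply/commuteX/commute_sym/commuteX.
  have [t] := relsN_expg_x (relsN_sym rel) EC' comFE'; rewrite Er [_.+1.-1]/=.
  (* The exponent exceeds [m + n], so an odd power of [Y] is an even power of [X]; combined with
     [Xr1] this makes an odd power of [X] an even one. *)
  have /dvdnP[q ->]: 2 ^ (m + n).+1 %| twist (2 ^ m * u) (2 ^ n * k) * t
                                     + 2 ^ n * k * k.
    apply: dvdn_add; first apply: dvdn_mulr.
      rewrite EK -mulnA (_ : (2 * m).-1 = (2 * m).-2.+1)%N; last by lia.
      by apply: dvdn_twist_2exp => //; lia.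
    have -> : (2 ^ n * k * k = 2 ^ ((2 * m).-1 + ((2 * m).-1 - n))
                               * (f * #[x].-1 * (f * #[x].-1)))%N.
      by rewrite EK /k expnD; ring.
    rewrite dvdn_mulr // dvdn_exp2l //; lia.
  have -> : (2 ^ (2 * n).-1 * g * #[y].-1 * k
             = 2 ^ (2 * n) * (2 * (2 ^ (2 * m - n - 3) * (f * g * #[x].-1 * #[y].-1))))%N.
    rewrite (_ : _ * k = 2 ^ ((2 * n).-1 + ((2 * m).-1 - n))
                          * (f * g * #[x].-1 * #[y].-1))%N; last first.
      by rewrite /k expnD; ring.
    rewrite (_ : _ + _ = 2 * n + 1 + (2 * m - n - 3))%N; last by lia.
    by rewrite !expnD expn1 -!mulnA.
  rewrite -[(_ * r * h)%N]mulnA (_ : n + n = 2 * n)%N; last by lia.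
  move/odd_expg_eq=> [|r' odd_r' Er']; first by rewrite oddM odd_r.
  by exists r' => //; exists q; rewrite /Y Er' -expgM expnS; congr (x ^+ _); ring.
have odd_r : odd (r1 * r2) by rewrite oddM odd_r1.
have odd_X : odd #[X].
  apply: (@odd_order_of_expg _ X (r1 * r2) (j1 * j2)) => //.
  by rewrite expgM Xr1 -expgM mulnC expgM Yr2 -expgM; congr (X ^+ _); ring.
have X1 w : X ^+ (#[X] * w) = 1 by rewrite expgM expg_order expg1n.
have Y1 w : Y ^+ (#[X] * (r2 * w)) = 1.
  by rewrite mulnCA expgM Yr2 -expgM mulnCA X1.
exists (h * r2 * #[X])%N, (g * (r2 * #[X]))%N; split.
- by rewrite !oddM odd_h odd_r2.
- by rewrite expgM -/X mulnC X1.
- rewrite expgM -/Y (_ : h * r2 * _ = #[X] * (r2 * h))%N; last by ring.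
  exact: Y1.
have Xf : (x ^+ (2 ^ (2 * m).-1 * f)) ^+ (r2 * #[X]) = 1.
  rewrite (_ : (2 * m).-1 = m + n + (m - n).-1)%N; last by lia.
  rewrite expnD -mulnA (expgM x) -/X -expgM.
  rewrite (_ : 2 ^ (m - n).-1 * f * (r2 * #[X])
               = #[X] * (2 ^ (m - n).-1 * f * r2))%N; last by ring.
  exact: X1.
rewrite (_ : _ * (h * _ * _) = 2 ^ n * h * (r2 * #[X]))%N; last by ring.
rewrite expgM EC expgMn // Xf mulg1 -expgM.
by rewrite -[(_ * g * _)%N]mulnA.
Qed.

(** * Factorization of the group and divisibility of its order *)

(** The product contains 1 and is stable under right multiplication by [x] and by [y]; for [y] the
    collection formula rewrites [x ^+ i * y] as [y], a power of [c], then a power of [x]. *)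
Lemma relsN_generated a b (gT : finGroupType) (x y : gT) : relsN a b x y ->
  <<[set x; y]>> \subset <[[~ x, y]]> <*> <[y]> * <[x]>.
Proof.
move=> rel; set K := <[[~ x, y]]> <*> <[y]>.
have Kc : [~ x, y] \in K by rewrite (subsetP (joing_subl _ _)) ?cycle_id.
have Ky : y \in K by rewrite (subsetP (joing_subr _ _)) ?cycle_id.
have Kx z : z \in K * <[x]> -> z * x \in K * <[x]>.
  by case/mulsgP=> k i Kk Ci ->; rewrite -mulgA mem_mulg // groupM ?cycle_id.
have Kxy z : z \in K * <[x]> -> z * y \in K * <[x]>.
  case/mulsgP=> k _ Kk /cycleP[i ->] ->.
  rewrite -mulgA (relsN_expg_comm rel) (relsN_xc rel) expgV_order -mulgA -expgD.
  by rewrite !mulgA mem_mulg ?mem_cycle // !groupM // groupX.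
apply/subsetP=> z /gen_prodgP[r [d xyd ->]]; elim: r d xyd => [|r IHr] d xyd.
  by rewrite big_ord0 -[1]mulg1 mem_mulg.
rewrite big_ord_recr /=.
have /set2P[-> | ->] := xyd ord_max; [apply: Kx | apply: Kxy]; exact: IHr.
Qed.

Lemma relsN_card_dvdn a b h (gT : finGroupType) (x y : gT) : relsN a b x y ->
  [~ x, y] ^+ h \in <[y]> -> #|<<[set x; y]>>| %| h * #[y] * #[x].
Proof.
move=> rel ch; set c := [~ x, y] in ch *; set K := <[c]> <*> <[y]>.
have sKG : K \subset <<[set x; y]>>.
  rewrite join_subG !cycle_subG (mem_gen (set22 x y)) groupR //.
    by rewrite (mem_gen (set21 x y)).
  by rewrite (mem_gen (set22 x y)).
have EG : <<[set x; y]>> = K * <[x]> :> {set gT}.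
  apply/eqP; rewrite eqEsubset (relsN_generated rel) mul_subG //.
  by rewrite cycle_subG (mem_gen (set21 x y)).
have EK : K = <[c]> * <[y]>.
  apply: norm_joinEl.
  by rewrite cycle_subG; have := relsN_norm_cycle rel 1; rewrite expg1.
have dK : #|K| %| h * #[y].
  (* The order of [c ^+ h] is that of [c] divided by the gcd with [h], and [c ^+ h] lies in the
     intersection. *)
  have dI : #[c] %| h * #|<[c]> :&: <[y]>|.
    rewrite -(divnK (dvdn_gcdl #[c] h)) -orderXgcd mulnC.
    by rewrite dvdn_mul ?dvdn_gcdr // order_dvdG // inE mem_cycle.
  have := mul_cardG <[c]> <[y]>; rewrite -EK -!orderE => E.
  rewrite -(@dvdn_pmul2r #|<[c]> :&: <[y]>|) ?cardG_gt0 // -E.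
  by rewrite mulnAC dvdn_mul.
have := mul_cardG (<[c]> <*> <[y]>) <[x]>; rewrite -EG -!orderE => E.
apply: (@dvdn_trans (#|K| * #[x])); last exact: dvdn_mul.
by rewrite E dvdn_mulr.
Qed.

(** * Permutation models over a finite ring: a translation and a shear *)

(** The coordinates record, up to corrections, the exponents of the shear, of the translation
    (scaled by [s]) and of the commutator (scaled by [d]); see [shear_word]. *)
Definition shift_fun (R : finComNzRingType) (s : R) (p : R * R * R) :=
  (p.1.1, p.1.2 + s, p.2)%R.

(* The shear is the identity off this domain, where the relation on y could fail:
   coordinates that should live modulo different powers of 2 are all embedded
   in the same ring R. *)
Definition shear_dom (R : finComNzRingType) (d w r : R) (p : R * R * R) :=
  [&& d * p.2 == 0, d * w * p.1.2 == 0 & r * p.1.2 == 0]%R.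

Definition shear_fun (R : finComNzRingType) (d w t r : R) (p : R * R * R) :=
  if shear_dom d w r p
  then (p.1.1 + 1 + p.2 + t * p.1.2, p.1.2, p.2 + w * p.1.2)%R else p.

Lemma shift_inj (R : finComNzRingType) (s : R) : injective (shift_fun s).
Proof. by case=> -[j i] k [[j' i'] k'] [-> /addIr-> ->]. Qed.

(** Stability of the domain is what makes the piecewise map injective. *)
Lemma shear_dom_fun (R : finComNzRingType) (d w t r : R) p :
  shear_dom d w r (shear_fun d w t r p) = shear_dom d w r p.
Proof.
rewrite /shear_fun; case: ifP => // /and3P[/eqP dk /eqP di /eqP ri].
by rewrite /shear_dom /= mulrDr dk mulrA di ri addr0 eqxx.
Qed.

Lemma shear_inj (R : finComNzRingType) (d w t r : R) :
  injective (shear_fun d w t r).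
Proof.
move=> p q E; have := shear_dom_fun d w t r p; rewrite E shear_dom_fun => Epq.
move: E; rewrite /shear_fun Epq; case: ifP => // _.
case: p q {Epq} => -[j i] k [[j' i'] k'] /= [+ ei ek]; subst i'.
by move/addIr: ek => <- /addIr/addIr/addIr->.
Qed.

Definition shift (R : finComNzRingType) (s : R) : {perm R * R * R} :=
  perm (@shift_inj R s).
Definition shear (R : finComNzRingType) (d w t r : R) : {perm R * R * R} :=
  perm (@shear_inj R d w t r).

Lemma shiftX (R : finComNzRingType) (s : R) k p :
  (shift s ^+ k) p = (p.1.1, p.1.2 + k%:R * s, p.2)%R.
Proof.
elim: k => [|k IHk]; first by rewrite perm1 mul0r addr0; case: p => -[].
by rewrite expgSr permM IHk permE /shift_fun /= -addrA -natr1 mulrDl mul1r.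
Qed.

Lemma shearX (R : finComNzRingType) (d w t r : R) k p :
  (shear d w t r ^+ k) p = if shear_dom d w r p
    then (p.1.1 + k%:R + k%:R * p.2 + ('C(k, 2)%:R * w + k%:R * t) * p.1.2, p.1.2,
          p.2 + k%:R * w * p.1.2)%R else p.
Proof.
elim: k => [|k IHk].
  rewrite perm1; case: ifP => // _; case: p => -[j i] q /=.
  by rewrite !mul0r !addr0 mul0r addr0.
rewrite expgSr permM IHk permE.
case: ifP => dp; last by rewrite /shear_fun dp.
have : shear_dom d w r ((shear d w t r ^+ k) p).
  elim: (k) => [|i IHi]; first by rewrite perm1.
  by rewrite expgSr permM permE shear_dom_fun.
rewrite IHk dp /shear_fun => -> /=; rewrite binS bin1 natrD -natr1.
by congr (_, _, _); ring.
Qed.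

Lemma shear_dom_shift (R : finComNzRingType) (d w s r : R) p :
  (d * w * s = 0 -> r * s = 0 -> shear_dom d w r (shift s p) = shear_dom d w r p)%R.
Proof.
by move=> dws rs; rewrite permE /shear_dom /= !mulrDr dws rs !addr0.
Qed.

Lemma shear_comm (R : finComNzRingType) (d w s t r : R) :
  (d = w * s)%R -> (d * d = 0)%R -> (r * s = 0)%R -> forall p,
  [~ shift s, shear d w t r] p =
    if shear_dom d w r p then (p.1.1 + t * s, p.1.2, p.2 + d)%R else p.
Proof.
move=> ds dd rs p; set x := shift s; set y := shear _ _ _ _.
(* Writing [p] as [(y * x) q] reduces the commutator to [x * y] at [q], so no inverse permutation is
   computed. *)
pose q := (y * x)^-1 p.
have -> : p = (y * x) q by rewrite permKV.
rewrite -permM (_ : y * x * _ = x * y); last first.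
  by rewrite commgEl conjgE !mulgA mulgK mulgV mul1g.
have dx p' : shear_dom d w r (x p') = shear_dom d w r p'.
  by apply: shear_dom_shift; rewrite // -mulrA -ds.
have dy : shear_dom d w r (y q) = shear_dom d w r q.
  by rewrite permE shear_dom_fun.
rewrite !permM dx dy; have := dx q; rewrite !permE /shear_fun => ->.
by case: ifP => //= _; rewrite /shift_fun /= ds; congr (_, _, _); ring.
Qed.

(** The two sides of [c * y = y ^+ b.+1 * c] differ by [d * p.2 + r * p.1.2] in the first coordinate
    and by [d * w * p.1.2] in the third; all three terms vanish on [shear_dom]. As [c] commutes with
    the translation, the other relation amounts to [a * s = 0]. *)
Lemma shear_rels (R : finComNzRingType) (d w s t r : R) (a b : nat) :
  d = (w * s)%R -> (d * d = 0)%R -> r = ('C(b.+1, 2)%:R * w + d * t)%R ->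
  (r * s = 0)%R -> b%:R%R = d -> (a%:R * s = 0)%R ->
  relsN a b (shift s) (shear d w t r).
Proof.
move=> ds dd rE rs bd as0; set x := shift s; set y := shear _ _ _ _.
have dx p : shear_dom d w r (x p) = shear_dom d w r p.
  by apply: shear_dom_shift; rewrite // -mulrA -ds.
have cE := shear_comm t ds dd rs; rewrite -/x -/y in cE.
have dc p : shear_dom d w r ([~ x, y] p) = shear_dom d w r p.
  rewrite cE; case: ifP => // dp; rewrite -[RHS]dp /shear_dom /= mulrDr.
  by rewrite dd addr0.
split; rewrite -?[[~ y, x]]invg_comm; move: [~ x, y] cE dc => c cE dc.
  rewrite conjgE; apply: (mulgI c); rewrite mulKVg; apply/permP=> p.
  rewrite !permM cE dx !shiftX cE -natr1 mulrDl as0 add0r mul1r.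
  by rewrite [x p]permE /shift_fun /=; case: ifP.
rewrite conjgE invgK mulgA; apply: (mulIg c); rewrite mulgKV.
apply/permP=> p.
have dyp : shear_dom d w r ((y ^+ b.+1) p) = shear_dom d w r p.
  elim: b.+1 => [|i IHi]; first by rewrite perm1.
  by rewrite expgSr permM permE shear_dom_fun.
rewrite permM (permM (y ^+ b.+1)) (cE ((y ^+ b.+1) p)) dyp shearX.
have := shearX d w t r 1 (c p); rewrite expg1 -/y dc => ->; rewrite cE.
case dp: (shear_dom d w r p) => //.
have /and3P[/eqP dk /eqP di /eqP ri] := dp.
rewrite -[b.+1%:R%R]natr1 bd (_ : 'C(1, 2) = 0%N) //=; congr (_, _, _).
  rewrite -[LHS]addr0 -[X in (_ + X)%R = _]dk -[LHS]addr0 -[X in (_ + X)%R = _]ri rE.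
  by ring.
by rewrite -[LHS]addr0 -[X in (_ + X)%R = _]di; ring.
Qed.

Lemma shear_comm_expg (R : finComNzRingType) (d w s t r : R) k :
  d = (w * s)%R -> (d * d = 0)%R -> (r * s = 0)%R -> forall p,
  ([~ shift s, shear d w t r] ^+ k) p = if shear_dom d w r p
    then (p.1.1 + k%:R * (t * s), p.1.2, p.2 + k%:R * d)%R else p.
Proof.
move=> ds dd rs p; have cE := shear_comm t ds dd rs.
move: [~ _, _] cE => c cE; elim: k => [|k IHk].
  by rewrite perm1 !mul0r !addr0; case: ifP; case: p => -[].
rewrite expgSr permM IHk cE; case dp: (shear_dom d w r p); last by rewrite dp.
rewrite {1}/shear_dom /= mulrDr mulrCA dd mulr0 addr0 [X in if X then _ else _]dp.
by rewrite -natr1; congr (_, _, _); ring.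
Qed.

Lemma shearX_commute (R : finComNzRingType) (d w s t r : R) k :
  d = (w * s)%R -> (d * d = 0)%R -> (r * s = 0)%R ->
  (k%:R * d = 0)%R -> (('C(k, 2)%:R * w + k%:R * t) * s = 0)%R ->
  commute (shift s) (shear d w t r ^+ k).
Proof.
move=> ds dd rs kd ks; have kws : (k%:R * w * s = 0)%R by rewrite -mulrA -ds.
apply/permP=> p; rewrite permM [RHS]permM shearX [RHS]permE shearX.
rewrite shear_dom_shift //; last by rewrite -mulrA -ds.
rewrite permE; case: ifP => _ //=; rewrite /shift_fun /=.
by rewrite !mulrDr ks kws !addr0.
Qed.

(** The origin lies in the domain, and its image alone serves to tell normal forms apart. *)
Lemma shear_word (R : finComNzRingType) (d w s t r : R) k j i :
  d = (w * s)%R -> (d * d = 0)%R -> (r * s = 0)%R ->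
  ([~ shift s, shear d w t r] ^+ k * shear d w t r ^+ j * shift s ^+ i) (0, 0, 0)%R
  = (k%:R * (t * s) + j%:R + j%:R * (k%:R * d), i%:R * s, k%:R * d)%R.
Proof.
move=> ds dd rs; rewrite 2!permM (shear_comm_expg t k ds dd rs).
rewrite {1}/shear_dom /= !mulr0 !eqxx /= !add0r shearX.
by rewrite {1}/shear_dom /= mulrCA dd !mulr0 !eqxx /= shiftX /= !addr0 add0r.
Qed.

Lemma shear_expg1 (R : finComNzRingType) (d w s t r : R) k :
  d = (w * s)%R -> (d * d = 0)%R -> (r * s = 0)%R ->
  (k%:R = 0 :> R)%R -> ('C(k, 2)%:R = 0 :> R)%R ->
  [/\ shift s ^+ k = 1, shear d w t r ^+ k = 1
    & [~ shift s, shear d w t r] ^+ k = 1].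
Proof.
move=> ds dd rs k0 k20.
by split; apply/permP=> p; rewrite ?(shear_comm_expg t k ds dd rs) ?shiftX ?shearX
   perm1 k0 ?k20 !mul0r ?addr0 ?mul0r ?addr0; try (case: ifP => _ //); case: p => -[].
Qed.

(** * The two models over residues modulo powers of 2 *)

Lemma Zp_nat_eq p i j : 1 < p ->
  (i%:R = j%:R :> 'Z_p)%R <-> i = j %[mod p].
Proof.
by move=> p1; rewrite -!val_Zp_nat //; split=> [-> // | /val_inj].
Qed.

Lemma Zp_nat_eq0 p i : 1 < p -> (i%:R = 0 :> 'Z_p)%R <-> p %| i.
Proof.
move=> p1; rewrite -[0%R]/(0%:R)%R Zp_nat_eq // mod0n.
by split=> [/eqP | /eqP].
Qed.

Lemma Zp_2exp_eq0 q N : 0 < q -> q < N ->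
  ((2 ^ N)%:R = 0 :> 'Z_(2 ^ q) /\ 'C(2 ^ N, 2)%:R = 0 :> 'Z_(2 ^ q))%R.
Proof.
move=> q0 qN; have q1 : 1 < 2 ^ q by rewrite -{1}(expn0 2) ltn_exp2l.
split; apply/Zp_nat_eq0 => //; first by rewrite dvdn_exp2l // ltnW.
by rewrite dvdn_bin2 // dvdn_mulr // dvdn_exp2l.
Qed.

Lemma pair_expg (gT hT : finGroupType) (x : gT) (y : hT) k :
  (x, y) ^+ k = (x ^+ k, y ^+ k).
Proof. by elim: k => // k IHk; rewrite !expgS IHk. Qed.

Definition model_type m n : finGroupType :=
  ({perm 'Z_(2 ^ (2 * n)) * 'Z_(2 ^ (2 * n)) * 'Z_(2 ^ (2 * n))} *
   {perm 'Z_(2 ^ (m + n)) * 'Z_(2 ^ (m + n)) * 'Z_(2 ^ (m + n))})%type.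

Lemma first_model m n u v : odd v -> 0 < n -> n < m ->
  exists x y : {perm 'Z_(2 ^ (2 * n)) * 'Z_(2 ^ (2 * n)) * 'Z_(2 ^ (2 * n))},
  [/\ relsN (2 ^ m * u) (2 ^ n * v) x y, commute x (y ^+ (2 ^ n)),
      x ^+ (2 ^ m) = 1,
      forall k j i k' j' i',
        [~ x, y] ^+ k * y ^+ j * x ^+ i = [~ x, y] ^+ k' * y ^+ j' * x ^+ i' ->
        k = k' %[mod 2 ^ n] /\ (k = k' -> j = j' %[mod 2 ^ (2 * n)])
    & (forall k, [~ x, y] ^+ k = 1 -> 2 ^ n.+1 %| k) /\
      forall N, 2 * n < N ->
        [/\ x ^+ (2 ^ N) = 1, y ^+ (2 ^ N) = 1 & [~ x, y] ^+ (2 ^ N) = 1]].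
Proof.
move=> odd_v n_gt0 lt_nm.
have ev : odd (2 ^ n) = false by rewrite oddX eqn0Ngt n_gt0.
set M := (2 ^ (2 * n))%N.
have M_gt1 : 1 < M by rewrite -{1}(expn0 2) ltn_exp2l //; lia.
have Z0 i : M %| i -> (i%:R = 0 :> 'Z_M)%R by move/Zp_nat_eq0->.
(* With [t = 1] the commutator adds [s] to the first coordinate, so its [2^n]-th power adds
   [2^(2n-1)], which is nonzero: hence the divisor [2^(n+1)] of its order. The choice [w = 2 v]
   gives [w * s = 2^n v]. *)
pose s : 'Z_M := ((2 ^ n.-1)%:R)%R; pose d : 'Z_M := ((2 ^ n * v)%:R)%R.
pose w : 'Z_M := ((2 * v)%:R)%R.
pose r : 'Z_M := ('C((2 ^ n * v).+1, 2)%:R * w + d * 1)%R.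
have n2 : (2 ^ n = 2 ^ n.-1 * 2)%N by rewrite -expnSr prednK.
have ds : d = (w * s)%R by rewrite /d /w /s -natrM; congr (_%:R)%R; rewrite n2; ring.
have dd : (d * d = 0)%R.
  by rewrite -natrM; apply: Z0; rewrite mulnACA -expnD dvdn_mulr // dvdn_exp2l; lia.
(* The product [2^n * 2^(n-1)] is one factor 2 short of [M]; [q * v + 1] supplies it because [q] and
   [v] are odd. *)
have oddM1 q : odd q -> M %| 2 ^ n * (q * v + 1) * 2 ^ n.-1.
  move=> odd_q; have /dvdnP[e ->] : 2 %| q * v + 1.
    by rewrite dvdn2 oddD oddM odd_q odd_v.
  rewrite (_ : M = 2 ^ n * 2 * 2 ^ n.-1)%N.
    by rewrite [(e * 2)%N]mulnC mulnA dvdn_mul // dvdn_mulr.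
  by rewrite -expnSr -expnD; congr (2 ^ _)%N; lia.
have rs : (r * s = 0)%R.
  rewrite /r mulr1 -natrM -natrD -natrM; apply: Z0.
  rewrite mulnA bin2_double [_.+1.-1]/=.
  rewrite (_ : _ * v + _ = 2 ^ n * ((2 ^ n * v).+1 * v + 1) * v)%N; last by ring.
  by rewrite mulnAC dvdn_mulr // oddM1 //= oddM ev.
exists (shift s), (shear d w 1%R r); split.
- apply: shear_rels => //.
  rewrite -natrM; apply: Z0; rewrite mulnAC -expnD dvdn_mulr // dvdn_exp2l //; lia.
- apply: shearX_commute => //.
    rewrite -natrM; apply: Z0; rewrite mulnA -expnD dvdn_mulr // dvdn_exp2l //; lia.
  rewrite mulr1 -natrM -natrD -natrM; apply: Z0.
  rewrite mulnA bin2_double (_ : _ * v + _ = 2 ^ n * ((2 ^ n).-1 * v + 1))%N; last by ring.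
  by rewrite oddM1 // -subn1 oddB ?expn_gt0 // ev.
- apply/permP=> p; rewrite shiftX perm1 /s -natrM Z0 ?addr0; last first.
    by rewrite -expnD dvdn_exp2l //; lia.
  by case: p => -[].
- move=> k j i k' j' i' E.
  have := congr1 (fun q : {perm _} => q (0, 0, 0)%R) E.
  rewrite !shear_word // => E0.
  have Ek := congr1 (fun q => q.2) E0; have E1 := congr1 (fun q => q.1.1) E0.
  rewrite /= in Ek E1.
  split.
    move: Ek; rewrite /d -!natrM => /Zp_nat_eq-/(_ M_gt1).
    have -> : M = (2 ^ n * 2 ^ n)%N by rewrite -expnD addnn -mul2n.
    by apply: eqmodn_cancel; rewrite ?expn_gt0 // coprimeXl // coprime2n.
  move=> ekk; move: E1; rewrite ekk -!addrA => /addrI.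
  rewrite /d -!natrM -!natrD => /Zp_nat_eq-/(_ M_gt1).
  (* Both exponents of [y] are multiplied by the same odd number [1 + k' * 2^n * v], a unit modulo
     [M]. *)
  rewrite -!mulnS => E1; apply: (@eqmodn_cancel 1 M (k' * (2 ^ n * v)).+1%N) => //.
    by rewrite coprimeXl // coprime2n /= !oddM ev andbF.
  by rewrite !mul1n.
split; last first.
  by move=> N ltN; have [||N0 C0] := @Zp_2exp_eq0 (2 * n) N; rewrite ?muln_gt0 //;
    apply: shear_expg1.
move=> k E; have := congr1 (fun q : {perm _} => q (0, 0, 0)%R) E.
have := shear_word 1%R k 0 0 ds dd rs; rewrite !expg0 !mulg1 => -> /=.
rewrite perm1 => /(congr1 (fun q => q.1.1)) /=.
rewrite mul0r !addr0 mul1r -natrM => /Zp_nat_eq0-/(_ M_gt1).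
rewrite (_ : M = 2 ^ n.+1 * 2 ^ n.-1)%N ?dvdn_pmul2r ?expn_gt0 // /M -expnD.
by congr (2 ^ _)%N; lia.
Qed.

(** Here [x] is the shear, with [t = 0], and [y] the translation. Only powers of [x] need to be
    separated, the exponents of [c] and [y] being read off in [first_model]. *)
Lemma second_model m n u v : 0 < n -> n < m ->
  exists x y : {perm 'Z_(2 ^ (m + n)) * 'Z_(2 ^ (m + n)) * 'Z_(2 ^ (m + n))},
  [/\ relsN (2 ^ m * u) (2 ^ n * v) x y, commute (x ^+ (2 ^ m)) y,
      y ^+ (2 ^ n) = 1
    & (forall i i', x ^+ i = x ^+ i' -> i = i' %[mod 2 ^ (m + n)]) /\
      forall N, m + n < N ->
        [/\ x ^+ (2 ^ N) = 1, y ^+ (2 ^ N) = 1 & [~ x, y] ^+ (2 ^ N) = 1]].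
Proof.
move=> n_gt0 lt_nm; set M := (2 ^ (m + n))%N.
have M_gt1 : 1 < M by rewrite -{1}(expn0 2) ltn_exp2l //; lia.
have Z0 i k : m + n <= k -> ((2 ^ k * i)%:R = 0 :> 'Z_M)%R.
  by move=> le_k; apply/Zp_nat_eq0; rewrite // dvdn_mulr // dvdn_exp2l.
pose s : 'Z_M := ((2 ^ m)%:R)%R; pose d : 'Z_M := ((2 ^ m * u)%:R)%R.
pose w : 'Z_M := (u%:R)%R.
pose r : 'Z_M := ('C((2 ^ m * u).+1, 2)%:R * w + d * 0)%R.
have ds : d = (w * s)%R by rewrite /d /w /s -natrM mulnC.
have dd : (d * d = 0)%R by rewrite -natrM mulnACA -expnD Z0 //; lia.
have C2 k q : (2 ^ m * q = k * k.-1)%N -> ('C(k, 2)%:R * w * s = 0)%R.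
  rewrite -bin2_double -!natrM => E.
  rewrite (_ : _ * 2 ^ m = 2 ^ (m + m.-1) * (q * u))%N; first by apply: Z0; lia.
  rewrite expnD.
  have {}E : ('C(k, 2) = 2 ^ m.-1 * q)%N.
    apply/eqP; rewrite -(eqn_pmul2r (isT : 0 < 2)) -E mulnAC -expnSr prednK //.
    exact: leq_ltn_trans lt_nm.
  by rewrite E; ring.
have rs : (r * s = 0)%R.
  by rewrite /r mulr0 addr0 (C2 _ (u * (2 ^ m * u).+1)%N) // mulnA mulnC.
exists (shear d w 0%R r), (shift s); split.
- apply/relsN_sym/shear_rels => //.
  by rewrite -natrM mulnAC -expnD Z0 // addnC.
- apply/commute_sym/shearX_commute => //.
    by rewrite -natrM mulnA -expnD Z0 //; lia.
  by rewrite mulr0 addr0 (C2 _ (2 ^ m).-1).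
- apply/permP=> p; rewrite shiftX perm1 /s -natrM -expnD -[(2 ^ _)%N]muln1.
  rewrite Z0 ?addr0; last by lia.
  by case: p => -[].
split; last first.
  move=> N ltN; have [||N0 C0] := @Zp_2exp_eq0 (m + n) N; rewrite ?addn_gt0 ?n_gt0 ?orbT //.
  have [-> -> c1] := shear_expg1 0%R ds dd rs N0 C0.
  by rewrite -invg_comm expVgn c1 invg1.
move=> i i' /(congr1 (fun q : {perm _} => q (0, 0, 0)%R)).
rewrite !shearX /shear_dom /= !mulr0 !eqxx /= => /(congr1 (fun q => q.1.1)) /=.
by rewrite !addr0 !add0r => /Zp_nat_eq; apply.
Qed.

Lemma model_exists m n u v : odd v -> 0 < n -> n < m ->
  exists x y : model_type m n,
  [/\ relsN (2 ^ m * u) (2 ^ n * v) x y,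
      commute x (y ^+ (2 ^ n)) /\ commute (x ^+ (2 ^ m)) y,
      forall k j i k' j' i', k < 2 ^ n -> j < 2 ^ (2 * n) -> i < 2 ^ (m + n) ->
        k' < 2 ^ n -> j' < 2 ^ (2 * n) -> i' < 2 ^ (m + n) ->
        [~ x, y] ^+ k * y ^+ j * x ^+ i = [~ x, y] ^+ k' * y ^+ j' * x ^+ i' ->
        [/\ k = k', j = j' & i = i'],
      2 ^ (m + n) %| #[x] /\ 2 ^ (2 * n) %| #[y]
    & 2 ^ n.+1 %| #[[~ x, y]] /\
      exists N, [/\ x ^+ (2 ^ N) = 1, y ^+ (2 ^ N) = 1 & [~ x, y] ^+ (2 ^ N) = 1]].
Proof.
move=> odd_v n_gt0 lt_nm.
have [x1 [y1 [rel1 com1 x1m word1 [c1 ord1]]]] := first_model u odd_v n_gt0 lt_nm.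
have [x2 [y2 [rel2 com2 y2n [word2 ord2]]]] := second_model u v n_gt0 lt_nm.
exists (x1, x2), (y1, y2).
have Ec : [~ (x1, x2), (y1, y2)] = ([~ x1, y1], [~ x2, y2]) by [].
split.
- split; rewrite pair_expg; [case: rel1 => <- _ | case: rel1 => _ <-];
  by [case: rel2 => <- _ | case: rel2 => _ <-].
- by rewrite !pair_expg x1m y2n; split; congr (_, _) => //; rewrite ?mulg1 ?mul1g.
(* The first component determines [k] and then [j]; after cancellation the second determines [i]. *)
- move=> k j i k' j' i' lk lj li lk' lj' li'; rewrite Ec !pair_expg => E.
  have /word1[] := congr1 fst E; rewrite !modn_small // => ek ej.
  have {}ej := ej ek.
  have := congr1 snd E; rewrite ek ej /= => /mulgI/word2.
  by rewrite !modn_small.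
- split.
    have := expg_order (x1, x2); rewrite pair_expg => /(congr1 snd) /= E.
    by apply/eqP; rewrite (word2 _ 0%N) ?mod0n.
  have := expg_order (y1, y2); rewrite pair_expg => /(congr1 fst) /= E.
  have /word1[_ /(_ erefl)] : [~ x1, y1] ^+ 0 * y1 ^+ #[(y1, y2)] * x1 ^+ 0
      = [~ x1, y1] ^+ 0 * y1 ^+ 0 * x1 ^+ 0 by rewrite E.
  by rewrite mod0n => /eqP.
split; last first.
  exists (2 * m + n)%N; rewrite Ec !pair_expg.
  have [|-> -> ->] := ord1 (2 * m + n)%N; first by lia.
  by have [|-> -> ->] := ord2 (2 * m + n)%N; first by lia.
by have := expg_order [~ (x1, x2), (y1, y2)]; rewrite {1}Ec pair_expg => /(congr1 fst) /= /c1.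
Qed.

(** * From integer to natural exponents *)

Lemma expgz_shift (gT : finGroupType) (x : gT) (z : int) k l :
  (z + k%:Z = l%:Z)%R -> expgz x z * x ^+ k = x ^+ l.
Proof.
case: z => i /= E; first by rewrite -expgD; congr (x ^+ _); lia.
have -> : k = (i.+1 + l)%N by lia.
by rewrite expgD mulKg.
Qed.

(** Write [z - 1] as plus or minus [2^p c] with [c] odd, and add [2^p W] with [W] a large even
    multiple of [e]: powers of [x] do not see the change, and the new cofactor [u] is odd, positive
    and as large as required. *)
Lemma expgz_2adic p (z : int) e B : 0 < p -> 0 < e -> v2 (z - 1)%R = p ->
  exists u, [/\ odd u, B <= 2 ^ p * u
    & forall (gT : finGroupType) (x : gT), x ^+ e = 1 ->
        expgz x z = x ^+ (2 ^ p * u).+1].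
Proof.
move=> p0 e0 zp; have z1 : 0 < `|(z - 1)%R|%N.
  by rewrite lt0n; apply: contraL p0 => /eqP E; rewrite -zp /v2 E.
have [c] := pfactor_coprime (isT : prime 2) z1.
rewrite coprime2n -/(v2 (z - 1)%R) zp => odd_c Ec.
have [W [even_W leW [q Wq]]] : exists W,
    [/\ ~~ odd W, B + c <= W & exists q, W = (e * q)%N].
  exists (2 * (e * (B + c)))%N; split; first by rewrite oddM.
    by rewrite mulnA leq_pmull // muln_gt0.
  by exists (2 * (B + c))%N; rewrite mulnCA.
have p2 : 0 < 2 ^ p by rewrite expn_gt0.
have cW : `|(z - 1)%R|%N <= 2 ^ p * W by rewrite Ec mulnC leq_pmul2l //; lia.
pose u := (if (0 <= z - 1)%R then W + c else W - c)%N.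
have Bu : B <= u by rewrite /u; case: ifP => _; lia.
have zu : (z + (2 ^ p * W)%N%:Z = (2 ^ p * u).+1%:Z)%R.
  rewrite /u; case: ifP => z0; rewrite ?mulnDr ?mulnBr [(2 ^ p * c)%N]mulnC -Ec;
    by move: (2 ^ p * W)%N cW => V; lia.
exists u; split.
- by rewrite /u; case: ifP => _; rewrite ?oddD ?oddB ?(negbTE even_W) //; lia.
- by apply: leq_trans Bu _; rewrite leq_pmull.
move=> gT x xe; rewrite -(expgz_shift x zu) Wq mulnCA expgM xe expg1n.
by rewrite mulg1.
Qed.

(** * Nilpotency class and size of the image *)

(** Modulo the center, which contains [x ^+ a] and [y ^+ b], the commutator becomes central, so the
    class is at most 3. In class 2, [c] itself would be central and [x = x ^+ a.+1]. *)
Lemma relsN_nil_class a b (gT : finGroupType) (H : {group gT}) (x y : gT) :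
    relsN a b x y -> H :=: <<[set x; y]>> -> nilpotent H ->
    commute (x ^+ a) y -> commute x (y ^+ b) -> x ^+ a != 1 ->
  nil_class H = 3.
Proof.
move=> rel EH nilH xay xyb xa1.
have Hx : x \in H by rewrite EH mem_gen ?set21.
have Hy : y \in H by rewrite EH mem_gen ?set22.
have EHj : H :=: <[x]> <*> <[y]> by rewrite EH joing_idl joing_idr.
have inZ z : z \in H -> commute z x -> commute z y -> z \in 'Z(H).
  move=> Hz zx zy; rewrite inE Hz /= EHj centY inE !cent_cycle.
  by apply/andP; split; apply/cent1P.
have Zx : x ^+ a \in 'Z(H) by apply: inZ; rewrite ?groupX //; apply/commute_sym/commuteX.
have Zy : y ^+ b \in 'Z(H) by apply: inZ; rewrite ?groupX //; apply/commute_sym/commuteX.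
have [xc yc] := rel.
have Nx : x \in 'N('Z(H)) by apply: subsetP Hx; apply: gFnorm.
have Ny : y \in 'N('Z(H)) by apply: subsetP Hy; apply: gFnorm.
apply/eqP; rewrite eqn_leq; apply/andP; split; last first.
  rewrite ltnNge nil_class2; apply: contra xa1 => sZ.
  have : [~ x, y] \in 'Z(H) by apply: (subsetP sZ); rewrite derg1 mem_commg.
  case/setIP=> _ /centP/(_ x Hx) cx.
  by apply/eqP/(mulgI x); rewrite mulg1 -expgS -xc conjgE -cx mulKg.
suff : nil_class (H / 'Z(H)) <= 2 by rewrite nil_class_quotient_center //; lia.
rewrite nil_class2.
have EQ : H / 'Z(H) = <[coset 'Z(H) x]> <*> <[coset 'Z(H) y]>.
  suff EQ (Z : {group gT}) : x \in 'N(Z) -> y \in 'N(Z) ->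
      H / Z = <[coset Z x]> <*> <[coset Z y]> by exact: EQ.
  by move=> ? ?; rewrite EHj quotientY ?cycle_subG // !quotient_cycle.
have Ecom : [~ coset 'Z(H) x, coset 'Z(H) y] = coset 'Z(H) [~ x, y].
  by rewrite morphR.
have cycx : [~ x, y] \in 'N('Z(H)) by rewrite groupR.
have cent_c : [~ coset 'Z(H) x, coset 'Z(H) y] \in 'C(H / 'Z(H)).
  have xk : coset 'Z(H) x ^ coset 'Z(H) [~ x, y] = coset 'Z(H) x.
    by rewrite -morphJ // xc expgS /= coset_kerr.
  have yk : coset 'Z(H) y ^ coset 'Z(H) [~ y, x] = coset 'Z(H) y.
    by rewrite -morphJ ?groupR // yc expgS /= coset_kerr.
  rewrite EQ centY inE !cent_cycle Ecom; apply/andP; split; apply/cent1P/commute_sym.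
    by apply/commgP/conjg_fixP.
  by rewrite -invg_comm morphV ?groupR //; apply/commuteV/commgP/conjg_fixP.
rewrite subsetI der_sub /= EQ der1_joing_cycles -?EQ // cycle_subG.
exact: cent_c.
Qed.

Lemma two_group_card_ge m n (hT : finGroupType) (H : {group hT}) (x y : hT) :
    x \in H -> y \in H ->
    (forall k j i k' j' i', k < 2 ^ n -> j < 2 ^ (2 * n) -> i < 2 ^ (m + n) ->
        k' < 2 ^ n -> j' < 2 ^ (2 * n) -> i' < 2 ^ (m + n) ->
        [~ x, y] ^+ k * y ^+ j * x ^+ i = [~ x, y] ^+ k' * y ^+ j' * x ^+ i' ->
        [/\ k = k', j = j' & i = i']) ->
  2 ^ (m + 4 * n) <= #|H|.
Proof.
move=> Hx Hy word.
pose h (p : 'I_(2 ^ n) * 'I_(2 ^ (2 * n)) * 'I_(2 ^ (m + n))) :=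
  [~ x, y] ^+ p.1.1 * y ^+ p.1.2 * x ^+ p.2.
have h_inj : injective h.
  case=> -[k j] i [[k' j'] i'] /word[] //= ek ej ei.
  by congr (_, _, _); apply: val_inj.
have sH : [set h p | p in setT] \subset H.
  by apply/subsetP=> _ /imsetP[p _ ->]; rewrite !groupM ?groupX ?groupR.
have := subset_leq_card sH; rewrite card_imset // cardsT !card_prod !card_ord.
by rewrite -!expnD; congr (2 ^ _ <= _); lia.
Qed.

(** * Transfer of both bounds to the Sylow 2-subgroup *)

Theorem theorem14p1 (alpha beta : int) (gT : finGroupType) (G : {group gT})
    (x y : gT) :
  alpha != 1%R -> beta != 1%R -> presents_G alpha beta G x y ->
  let m := v2 (alpha - 1)%R in
  let n := v2 (beta - 1)%R in
  let l := v2 (alpha - beta)%R in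
  (1 < n)%N -> (n < m)%N -> n = l ->
  forall P : {group gT}, P \in 'Syl_2(G) ->
  [/\ #|P| = (2 ^ (m + 4 * n))%N, nil_class P = 3%N,
      #[x.`_2] = (2 ^ (m + n))%N, #[y.`_2] = (2 ^ (2 * n))%N
    & #[([~ x, y]).`_2] = (2 ^ (n + 1))%N].
Proof.
move=> _ _ [EG rel univ] m n l n_gt1 lt_nm _ P.
have n_gt0 := ltnW n_gt1; have m_gt0 := ltn_trans n_gt0 lt_nm.
rewrite inE => sylP.
set hT := model_type m n.
(* This exponent kills both the given group and the model, so the same [u] and [v] replace [alpha]
   and [beta] in both. *)
pose e := (#|[set: gT]| * #|[set: hT]|)%N.
have e_gt0 : 0 < e by rewrite muln_gt0 !cardG_gt0.
have [v [odd_v _ Ev]] := expgz_2adic 0 n_gt0 e_gt0 (erefl (v2 (beta - 1)%R)).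
have [u [odd_u le_ba Eu]] :=
  expgz_2adic (2 ^ n * v) m_gt0 e_gt0 (erefl (v2 (alpha - 1)%R)).
rewrite -/m -/n in Eu Ev le_ba.
have ge (z : gT) : z ^+ e = 1.
  by rewrite /e expgM (@expg_cardG _ [set: gT]%G) ?inE // expg1n.
have he (z : hT) : z ^+ e = 1.
  by rewrite /e mulnC expgM (@expg_cardG _ [set: hT]%G) ?inE // expg1n.
have relN : relsN (2 ^ m * u) (2 ^ n * v) x y.
  by case: rel => r1 r2; split; rewrite ?r1 ?r2 ?Eu ?Ev.
have [X [Y [relM [comY comX] word [oX oY] [oC [N [XN YN CN]]]]]] :=
  model_exists u odd_v n_gt0 lt_nm.
have [f [fx fy]] : exists f : {morphism G >-> hT}, f x = X /\ f y = Y.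
  by apply: univ; case: relM => r1 r2; split; rewrite ?r1 ?r2 ?Eu ?Ev.
have Gx : x \in G by rewrite EG mem_gen ?set21.
have Gy : y \in G by rewrite EG mem_gen ?set22.
have fc : f [~ x, y] = [~ X, Y] by rewrite morphR // fx fy.
have EH : f @* G = <<[set X; Y]>>.
  have sxyG : [set x; y] \subset G by rewrite EG subset_gen.
  have -> : f @* G = f @* <<[set x; y]>> by rewrite -EG.
  by rewrite morphim_gen // morphimEsub // imsetU1 imset_set1 fx fy.
have [w [g [odd_w xw yw cw]]] := relsN_bounds relN odd_u odd_v n_gt1 lt_nm le_ba.
have x2 : #[x]`_2 %| 2 ^ (m + n) by apply: part2_dvdn odd_w _; rewrite order_dvdn xw.
have y2 : #[y]`_2 %| 2 ^ (2 * n) by apply: part2_dvdn odd_w _; rewrite order_dvdn yw.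
have c2 : #[[~ x, y]]`_2 %| 2 ^ n.+1.
  have odd_ww : odd (w * w) by rewrite oddM odd_w.
  apply: part2_dvdn odd_ww _.
  (* Raising [cw] to the power [2 * w] gives a power of [y ^+ (2 ^ (2 * n) * w)], which is 1. *)
  rewrite order_dvdn expnSr (_ : _ * _ = 2 ^ n * w * (2 * w))%N; last by ring.
  rewrite expgM cw -expgM (_ : _ * _ = 2 ^ (2 * n).-1.+1 * w * g)%N.
    by rewrite prednK ?muln_gt0 ?n_gt0 // expgM yw expg1n.
  by rewrite expnS; ring.
have P_dvd : #|P| %| 2 ^ (m + 4 * n).
  rewrite (card_Hall sylP).
  have cy : [~ x, y] ^+ (2 ^ n * w) \in <[y]> by rewrite cw mem_cycle.
  have := relsN_card_dvdn relN cy; rewrite -EG => /(partn_dvd 2).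
  rewrite !muln_gt0 expn_gt0 (odd_gt0 odd_w) !order_gt0 => /(_ isT).
  move/dvdn_trans; apply; rewrite !partnM ?muln_gt0 ?expn_gt0 ?order_gt0 ?(odd_gt0 odd_w) //.
  rewrite (_ : m + 4 * n = n + 2 * n + (m + n))%N; last by lia.
  rewrite 2!expnD !dvdn_mul // -partnM ?expn_gt0 ?(odd_gt0 odd_w) //.
  exact: part2_dvdn odd_w _.
have H_ge : 2 ^ (m + 4 * n) <= #|f @* G|.
  by apply: two_group_card_ge word; rewrite -?fx -?fy mem_morphim.
have H2 : 2.-group (f @* G).
  have cN : [~ X, Y] ^+ (2 ^ N) \in <[Y]> by rewrite CN group1.
  have := relsN_card_dvdn relM cN; rewrite -EH => /pnat_dvd; apply.
  have ordN (Z : hT) : Z ^+ (2 ^ N) = 1 -> 2.-nat #[Z].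
    by move/eqP; rewrite -order_dvdn => /pnat_dvd; apply; rewrite pnatX pnat_id.
  by rewrite !pnatM !ordN // pnatX pnat_id.
have sPG : P \subset G := pHall_sub sylP.
(* The image of [P] is a Sylow 2-subgroup of the 2-group [f @* G], hence all of it. *)
have EP : f @* P = f @* G.
  have := morphim_pHall f sPG sylP.
  by move/pHall_id => ->.
have cardP : #|P| = (2 ^ (m + 4 * n))%N.
  apply/eqP; rewrite eqn_leq dvdn_leq ?expn_gt0 //=.
  by apply: leq_trans H_ge _; rewrite -EP leq_morphim.
have dvd_order (z : gT) : z \in G -> #[f z]`_2 %| #[z]`_2.
  by move=> Gz; rewrite partn_dvd // morph_order.
have pow2 k q : 2 ^ k %| q -> 0 < q -> 2 ^ k %| q`_2.
  by move=> dq q0; have := partn_dvd 2 q0 dq; rewrite part_pnat_id ?pnatX ?pnat_id.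
split=> //.
(* Equality of orders makes [f] an isomorphism on [P], so the class can be computed in the model. *)
- have isoP : f @* G \isog P by rewrite -EP isogEcard morphim_homg //= EP cardP.
  rewrite -(isog_nil_class isoP).
  apply: (relsN_nil_class relM EH (pgroup_nil H2)).
  - by rewrite expgM; apply/commute_sym/commuteX/commute_sym.
  - by rewrite expgM; apply: commuteX.
  (* Otherwise [2^(m+n)] would divide [2^m u], against [n > 0] and [u] odd. *)
  rewrite -order_dvdn; apply/negP => /(dvdn_trans oX).
  rewrite expnD dvdn_pmul2l ?expn_gt0 // => /(dvdn_trans (dvdn_exp2l 2 n_gt0)).
  by rewrite expn1 dvdn2 odd_u.
- rewrite order_constt; apply/eqP; rewrite eqn_dvd x2 /=.
  by rewrite (dvdn_trans _ (dvd_order x Gx)) // fx pow2.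
- rewrite order_constt; apply/eqP; rewrite eqn_dvd y2 /=.
  by rewrite (dvdn_trans _ (dvd_order y Gy)) // fy pow2.
rewrite order_constt addn1; apply/eqP; rewrite eqn_dvd c2 /=.
by rewrite (dvdn_trans _ (dvd_order _ (groupR Gx Gy))) // fc pow2.
Qed.
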